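(* Let $n\ge1$. The number of sequences $(I^1,\dots,I^{n-1})$ of subsets $I^d\subset\{1,\dots,n\}$ with $\#I^d=d$ satisfying $$I^d\setminus\{d+1\}\subset I^{d+1},\qquad d=1,\dots,n-2,$$ is equal to the normalized median Genocchi number $h_n$.
   Context: The normalized median Genocchi number $h_n$ is defined as the number of elements of the set $DC_n$ of Dellac configurations. Consider a rectangle with $n$ columns and $2n$ rows, whose boxes are labeled by pairs $(l,j)$, where $l=1,\dots,n$ is the number of the column and $j=1,\dots,2n$ is the number of the row. A Dellac configuration $D$ is a subset of boxes such that: each column contains exactly two boxes from $D$; each row contains exactly one box from $D$; and if $(l,j)\in D$, then $l\le j\le n+l$. (The first values $h_1,h_2,\dots$ are $1,2,7,38,295$.) *)

(* Defs.v *)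
From mathcomp Require Import all_boot.

Set Implicit Arguments.
Unset Strict Implicit.
Unset Printing Implicit Defensive.

(* The set {1, ..., m} is encoded by 'I_m; [label i] is the 1-based number
   of the index i. *)
Definition label (m : nat) (i : 'I_m) : nat := i.+1.

(* A box is a pair (column, row). *)
Definition dellac (n : nat) (D : {set 'I_n * 'I_(2 * n)}) : bool :=
  [&& [forall l : 'I_n, #|[set j : 'I_(2 * n) | (l, j) \in D]| == 2],
      [forall j : 'I_(2 * n), #|[set l : 'I_n | (l, j) \in D]| == 1]
    & [forall l : 'I_n, forall j : 'I_(2 * n),
        ((l, j) \in D) ==> (label l <= label j <= n + label l)]].

Definition DC (n : nat) : {set {set 'I_n * 'I_(2 * n)}} :=
  [set D | dellac D].

Definition median_genocchi (n : nat) : nat := #|DC n|.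

(* I^d is [I i] with [label i = d]. The second clause concerns consecutive
   indices of 'I_n.-1, hence exactly d = 1, ..., n - 2. *)
Definition admissible (n : nat) (I : {ffun 'I_n.-1 -> {set 'I_n}}) : bool :=
  [forall d : 'I_n.-1, #|I d| == label d] &&
  [forall d : 'I_n.-1, forall e : 'I_n.-1,
    (label e == (label d).+1) ==>
      (I d :\: [set x : 'I_n | label x == (label d).+1] \subset I e)].

(* Main.v *)
Require Import Defs.
From mathcomp Require Import all_boot.
From mathcomp Require Import zify.

Set Implicit Arguments.
Unset Strict Implicit.
Unset Printing Implicit Defensive.

(** Put I^0 = set0 and I^n = {1, ..., n}. In a Dellac configuration let P_e be
    the set of the 2e rows whose box lies in one of the first e columns. The
    bounds on the boxes say that {1, ..., e} <= P_e <= {1, ..., n + e}, so P_e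
    is determined by the set I^e of those x such that row x (if x > e), resp.
    row n + x (if x <= e), is in P_e. Then #|I^e| = 2e - e = e, and
    P_e <= P_(e+1) becomes I^e \ {e+1} <= I^(e+1): at step e+1 the tracked row
    of the element e+1 is switched from row e+1 to row n+e+1. *)

(** A chain from the empty set to the whole set amounts to recording when each point enters: [c j]
    is one less than the first [e] with [j] in [P e], and that [e] is positive because [P 0] is
    empty. *)
Lemma chain_rank (T : finType) n (P : nat -> {set T}) :
    P 0 = set0 -> P n = setT -> (forall e, e < n -> P e \subset P e.+1) ->
  exists c : {ffun T -> 'I_n}, forall j e, e <= n -> (c j < e) = (j \in P e).
Proof.
move=> P0 Pn Pmono.
have homoP d e : d <= e -> e <= n -> P d \subset P e.
  elim: e => [|e IH]; first by rewrite leqn0 => /eqP->.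
  rewrite leq_eqVlt => /predU1P[-> // | lede] len.
  by rewrite (subset_trans (IH _ (ltnW len))) // Pmono.
have /fin_all_exists[c cP] (j : T) :
    exists l : 'I_n, forall e, e <= n -> (l < e) = (j \in P e).
  have exP : exists e, j \in P e by exists n; rewrite Pn inE.
  have [] := ex_minnP exP; case=> [|m] mP min_m; first by rewrite P0 inE in mP.
  have lemn : m < n by apply: min_m; rewrite Pn inE.
  exists (Ordinal lemn) => e len; apply/idP/idP => /= [ltme | /min_m //].
  exact: subsetP (homoP _ _ ltme len) _ mP.
by exists [ffun j => c j] => j e; rewrite ffunE; apply: cP.
Qed.

Lemma card_rank_ltnS (T : finType) n (c : T -> 'I_n) (l : 'I_n) :
  #|[set j | c j < l.+1]| = #|[set j | c j < l]| + #|[set j | c j == l]|.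
Proof.
rewrite -cardsUI [#|_ :&: _|]eq_card0 ?addn0 => [|j].
  by apply: eq_card => j; rewrite !inE ltnS leq_eqVlt orbC.
by rewrite !inE -(inj_eq val_inj) /=; case: ltngtP.
Qed.

Lemma card_ord_ltn n e : e <= n -> #|[set x : 'I_n | x < e]| = e.
Proof.
by move=> len; rewrite -sum1dep_card (big_ord_narrow len) sum1_card card_ord.
Qed.

Section Rows.

Variable n : nat.
Implicit Types (x : 'I_n) (e : nat) (J : {set 'I_n}).

Lemma top_subproof x : x < 2 * n. Proof. by have := ltn_ord x; lia. Qed.
Lemma bot_subproof x : n + x < 2 * n. Proof. by have := ltn_ord x; lia. Qed.
Definition top x : 'I_(2 * n) := Ordinal (top_subproof x).
Definition bot x : 'I_(2 * n) := Ordinal (bot_subproof x).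

Lemma top_inj : injective top.
Proof. by move=> x y [/val_inj]. Qed.

Lemma bot_inj : injective bot.
Proof. by move=> x y [/addnI/val_inj]. Qed.

Lemma top_neq_bot x y : top x != bot y.
Proof. by rewrite -(inj_eq val_inj) /= neq_ltn ltn_addr. Qed.

Variant row_spec : 'I_(2 * n) -> Prop :=
| RowTop x : row_spec (top x)
| RowBot x : row_spec (bot x).

Lemma rowP j : row_spec j.
Proof.
case: (ltnP j n) => [ltjn | lenj].
  by rewrite (_ : j = top (Ordinal ltjn)); [left | apply: val_inj].
have ltj : j - n < n by have := ltn_ord j; lia.
rewrite (_ : j = bot (Ordinal ltj)); first by right.
by apply: val_inj; rewrite /= subnKC.
Qed.

(* The set P_e as a function of J = I^e. *)
Definition prefix_rows e J : {set 'I_(2 * n)} :=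
  let A := [set x : 'I_n | x < e] in top @: (A :|: J) :|: bot @: (A :&: J).

Lemma top_prefix_rows e J x : (top x \in prefix_rows e J) = (x < e) || (x \in J).
Proof.
rewrite in_setU (mem_imset _ _ top_inj) !inE orbC.
by case: imsetP => [[y _ /eqP]|] //; rewrite (negPf (top_neq_bot _ _)).
Qed.

Lemma bot_prefix_rows e J x : (bot x \in prefix_rows e J) = (x < e) && (x \in J).
Proof.
rewrite in_setU (mem_imset _ _ bot_inj) !inE.
case: imsetP => [[y _ /eqP]|] //.
by rewrite eq_sym (negPf (top_neq_bot _ _)).
Qed.

(** Union and intersection of two sets have together as many elements as the two sets, and the
    images of [top] and [bot] are disjoint. *)
Lemma card_prefix_rows e J : e <= n -> #|prefix_rows e J| = e + #|J|.
Proof.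
move=> len; rewrite -{2}(card_ord_ltn len) -cardsUI.
rewrite -(card_imset _ top_inj) -(card_imset _ bot_inj) -cardsUI.
rewrite [X in _ = _ + X]eq_card0 ?addn0 // => j.
rewrite !inE; apply/andP=> -[/imsetP[x _ ->] /imsetP[y _ /eqP]].
by rewrite (negPf (top_neq_bot _ _)).
Qed.

Definition tracked_row e x : 'I_(2 * n) := if x < e then bot x else top x.

Lemma tracked_prefix_rows e J x :
  (tracked_row e x \in prefix_rows e J) = (x \in J).
Proof.
rewrite /tracked_row; case: ifPn => ltxe.
  by rewrite bot_prefix_rows ltxe.
by rewrite top_prefix_rows (negPf ltxe).
Qed.

(* A Dellac configuration has one box in each row, so it is the graph of the
   function c sending a row to the column of its box. *)
Definition dellac_fun (c : {ffun 'I_(2 * n) -> 'I_n}) : bool :=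
  [forall l, #|[set j | c j == l]| == 2] && [forall j, c j <= j <= n + c j].

Definition dellac_graph (c : {ffun 'I_(2 * n) -> 'I_n}) :
  {set 'I_n * 'I_(2 * n)} := [set p | c p.2 == p.1].

Lemma dellac_graphE c : dellac (dellac_graph c) = dellac_fun c.
Proof.
rewrite /dellac /dellac_fun; congr andb.
  by apply: eq_forallb => l; congr (_ == 2); apply: eq_card => j; rewrite !inE.
have -> /= : [forall j, #|[set l | (l, j) \in dellac_graph c]| == 1].
  apply/forallP=> j; apply/cards1P; exists (c j); apply/setP=> l.
  by rewrite !inE eq_sym.
apply/forallP/forallP => [cP j | cP l].
  have /forallP/(_ j) := cP (c j); rewrite inE eqxx /= /label.
  by rewrite addnS !ltnS.
apply/forallP=> j; rewrite inE /=; apply/implyP => /eqP<-.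
by rewrite /label addnS !ltnS.
Qed.

Lemma median_genocchi_fun : median_genocchi n = #|[set c | dellac_fun c]|.
Proof.
have graph_inj : injective dellac_graph.
  move=> c c' /setP eqcc'; apply/ffunP=> j.
  by have := eqcc' (c j, j); rewrite !inE eqxx => /esym/eqP.
rewrite -(card_imset _ graph_inj); apply: eq_card => D.
rewrite inE; apply/idP/imsetP => [DD | [c + ->]]; last first.
  by rewrite inE dellac_graphE.
have /fin_all_exists[c cP] (j : 'I_(2 * n)) :
    exists l0 : 'I_n, forall l, ((l, j) \in D) = (l == l0).
  case/and3P: DD => _ /forallP/(_ j)/cards1P[l0 Dj] _.
  by exists l0 => l; move/setP/(_ l): Dj; rewrite !inE.
have defD : D = dellac_graph [ffun j => c j].
  by apply/setP=> -[l j]; rewrite inE /= ffunE cP eq_sym.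
by exists [ffun j => c j]; rewrite // inE -dellac_graphE -defD.
Qed.

(* The sequence I^0 = set0, I^1, ..., I^(n-1), I^n = setT. *)
Definition extend (I : {ffun 'I_n.-1 -> {set 'I_n}}) e : {set 'I_n} :=
  if e is d.+1 then if insub d is Some d' then I d' else setT else set0.

Definition tracked_sets (c : {ffun 'I_(2 * n) -> 'I_n}) :
    {ffun 'I_n.-1 -> {set 'I_n}} :=
  [ffun d : 'I_n.-1 => [set x | c (tracked_row d.+1 x) < d.+1]].

Lemma extendS I (d : 'I_n.-1) : extend I d.+1 = I d.
Proof. by rewrite /extend valK. Qed.

Lemma extend_full I : 0 < n -> extend I n = setT.
Proof. by move=> n_gt0; rewrite -[X in extend I X]prednK //= insubN // ltnn. Qed.

Lemma extend_tracked_sets c e x : e <= n ->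
  (x \in extend (tracked_sets c) e) = (c (tracked_row e x) < e).
Proof.
case: e => [|d] ltdn; first by rewrite inE.
rewrite /extend; case: insubP => [d' _ <- | ltd]; first by rewrite ffunE inE.
rewrite inE; apply/esym; have := ltn_ord (c (tracked_row d.+1 x)); lia.
Qed.

(** One row of each pair [top x], [bot x] is untracked at step [e], and the Dellac bounds decide its
    membership: if [x < e] then [c (top x) <= x < e], and otherwise [e <= x <= c (bot x)]. *)
Lemma tracked_setsK c e j : dellac_fun c -> e <= n ->
  (j \in prefix_rows e (extend (tracked_sets c) e)) = (c j < e).
Proof.
case/andP=> _ /forallP cP len.
case: j / (rowP j) => x; have /andP[] := cP (top x); have /andP[] := cP (bot x);
  rewrite ?top_prefix_rows ?bot_prefix_rows extend_tracked_sets // /tracked_row;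
  case: ltnP => //=; lia.
Qed.

Lemma card_extend I e : admissible I -> 0 < n -> e <= n -> #|extend I e| = e.
Proof.
case/andP=> /forallP cardI _ n_gt0; case: e => [|d] ltdn; first exact: cards0.
rewrite /extend; case: insubP => [d' _ <- | ltd]; first exact/eqP/cardI.
by rewrite cardsT card_ord; lia.
Qed.

(** The index [e] has label e+1, so this is the defining inclusion, prolonged to both ends of the
    sequence: it is trivial from [set0] and into [setT]. *)
Lemma extend_step I e x : admissible I -> e < n ->
  x \in extend I e -> x != e :> nat -> x \in extend I e.+1.
Proof.
case/andP=> _ /forallP stepI; case: e => [|d] ltdn; first by rewrite inE.
rewrite {2}/extend; case: insubP => [e' _ def_e | _ _ _]; last by rewrite inE.
have ltd : d < n.-1 by lia.
rewrite (extendS I (Ordinal ltd)) => xI neqx.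
have /forallP/(_ e')/implyP sub := stepI (Ordinal ltd).
apply: (subsetP (sub _)); first by rewrite /label def_e.
by rewrite !inE xI andbT /label eqSS.
Qed.

(** The sets determine every comparison [c j < e] with [e <= n], and these comparisons determine
    [c j]. *)
Lemma tracked_sets_inj : {in [set c | dellac_fun c] &, injective tracked_sets}.
Proof.
move=> c c'; rewrite !inE => cP c'P eqcc'; apply/ffunP=> j.
have eq_lt e : e <= n -> (c j < e) = (c' j < e).
  by move=> len; rewrite -!tracked_setsK // eqcc'.
have := eq_lt _ (ltn_ord (c j)); have := eq_lt _ (ltn_ord (c' j)).
rewrite !ltnSn !ltnS => lecc' lec'c; apply/val_inj/anti_leq.
by rewrite lecc' -lec'c.
Qed.

Lemma card_dellac_fun_ltn c e :
  dellac_fun c -> e <= n -> #|[set j | c j < e]| = 2 * e.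
Proof.
case/andP=> /forallP card2 _; elim: e => [|e IH] len.
  by apply: eq_card0 => j; rewrite inE.
rewrite (card_rank_ltnS c (Ordinal len)) IH ?(ltnW len) //.
by rewrite (eqP (card2 _)) mulnS addnC.
Qed.

Lemma tracked_sets_admissible c : dellac_fun c -> admissible (tracked_sets c).
Proof.
move=> cP; apply/andP; split; apply/forallP=> d.
  have ledn : d.+1 <= n by have := ltn_ord d; lia.
  (* Adding [d.+1] to both sides turns the claim into the count of the [2 * d.+1] rows in the first
     [d.+1] columns. *)
  rewrite -(eqn_add2l d.+1) -extendS -card_prefix_rows // addnn -mul2n.
  rewrite -(card_dellac_fun_ltn cP ledn); apply/eqP/eq_card => j.
  by rewrite tracked_setsK ?inE.
apply/forallP=> e; apply/implyP; rewrite /label => /eqP[def_e].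
apply/subsetP=> x; rewrite -!extendS def_e !inE eqSS => /andP[neqx].
have := ltn_ord e; rewrite def_e => lten.
rewrite !extend_tracked_sets; [|lia|lia]; rewrite /tracked_row.
(* As [x] differs from [d.+1], its tracked row is the same at steps [d.+1] and [d.+2]; only the
   bound on the column grows. *)
by rewrite [x < d.+2]ltnS [x <= _]leq_eqVlt (negPf neqx) /=; apply: ltnW.
Qed.

Lemma tracked_sets_surj I : 0 < n -> admissible I ->
  exists2 c, dellac_fun c & I = tracked_sets c.
Proof.
move=> n_gt0 admI; pose P e := prefix_rows e (extend I e).
have P0 : P 0 = set0.
  apply/setP=> j; case: j / (rowP j) => x; rewrite ?top_prefix_rows ?bot_prefix_rows;
  by rewrite !inE.
have Pn : P n = setT.
  apply/setP=> j; case: j / (rowP j) => x; rewrite ?top_prefix_rows ?bot_prefix_rows;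
  by rewrite extend_full // !inE ltn_ord.
have Pmono e : e < n -> P e \subset P e.+1.
  move=> lten; apply/subsetP=> j.
  (* The exempt element [x = e] causes no trouble: [top x] always lies in [P e.+1], and [bot x] is
     never in [P e]. *)
  case: j / (rowP j) => x; rewrite ?top_prefix_rows ?bot_prefix_rows ltnS.
    case: (ltngtP x e) => //= ltex xI.
    by rewrite (extend_step admI lten) // gtn_eqF.
  by case/andP=> ltxe xI; rewrite ltnW //= (extend_step admI lten) // ltn_eqF.
have [c cP] := chain_rank P0 Pn Pmono; exists c; last first.
  apply/ffunP=> d; apply/setP=> x; rewrite ffunE inE cP.
    by rewrite tracked_prefix_rows extendS.
  by have := ltn_ord d; lia.
have card_lt e : e <= n -> #|[set j | c j < e]| = e + e.
  move=> len; rewrite -[X in _ + X](card_extend admI n_gt0 len).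
  rewrite -card_prefix_rows //.
  by apply: eq_card => j; rewrite -[RHS]cP ?inE.
apply/andP; split; apply/forallP.
  move=> l; apply/eqP.
  have := card_rank_ltnS c l; rewrite (card_lt l.+1) // (card_lt l) 1?ltnW //.
  by rewrite addSn addnS -addn2 => /addnI <-.
move=> j; case: j / (rowP j) => x.
  (* Lower bound: [top x] lies in [P x.+1] whatever the sets are, hence [c (top x) <= x]. *)
  have := cP (top x) x.+1 (ltn_ord x); rewrite top_prefix_rows ltnSn ltnS /=.
  by move=> ->; have := ltn_ord x; lia.
(* Upper bound: [bot x] can lie in [P e] only if [x < e]; take for [e] the step at which it
   enters. *)
have := cP (bot x) (c (bot x)).+1 (ltn_ord _).
rewrite bot_prefix_rows ltnSn ltnS => /esym/andP[lexc _] /=.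
by rewrite leq_add2l lexc andbT ltnW // ltn_addr.
Qed.

End Rows.

Theorem theorem0p2 (n : nat) (n_gt0 : 0 < n) :
  #|[set I : {ffun 'I_n.-1 -> {set 'I_n}} | admissible I]| = median_genocchi n.
Proof.
rewrite median_genocchi_fun -(card_in_imset (@tracked_sets_inj n)).
apply: eq_card => I; rewrite inE; apply/idP/imsetP => [admI | [c + ->]].
  have [c cP ->] := tracked_sets_surj n_gt0 admI.
  by exists c; rewrite ?inE.
by rewrite inE; apply: tracked_sets_admissible.
Qed.
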